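(* Ferrers ideals are Mayer-Vietoris ideals of type $A$.
   Context: $\mathbf{k}$ is a field of characteristic $0$. A Ferrers graph is a bipartite graph $G$ on two distinct vertex sets $X=\{x_1,\dots,x_n\}$ and $Y=\{y_1,\dots,y_m\}$ such that if $(x_i,y_j)$ is an edge of $G$, then so is $(x_p,y_q)$ for $1\leq p\leq i$, $1\leq q\leq j$; in addition $(x_1,y_m)$ and $(x_n,y_1)$ are required to be edges. A Ferrers ideal is the edge ideal of a Ferrers graph, i.e. the ideal of $\mathbf{k}[x_1,\dots,x_n,y_1,\dots,y_m]$ generated by the products $x_iy_j$ with $(x_i,y_j)$ an edge. Equivalently, with $\lambda_i$ the degree of $x_i$ in $G$ (so $\lambda_1=m\geq\lambda_2\geq\cdots\geq\lambda_n\geq 1$), it is $I_\lambda=\langle x_iy_j\mid 1\le i\le n,\ 1\leq j\leq\lambda_i\rangle$. Mayer-Vietoris trees: a Mayer-Vietoris tree $MVT(I)$ of a nonzero monomial ideal $I$ is a rooted binary tree whose nodes are (labelled by) monomial ideals, with root $I$. Whenever a node $J$ has minimal monomial generating set $\{m_1,\dots,m_s\}$ with $s\geq 2$, one minimal generator (the pivot monomial) is chosen, the choice being arbitrary at each node; numbering so that the pivot is $m_s$, the node $J$ has exactly two children: the left child $\tilde J=\langle m_1,\dots,m_{s-1}\rangle\cap\langle m_s\rangle=\langle \mathrm{lcm}(m_1,m_s),\dots,\mathrm{lcm}(m_{s-1},m_s)\rangle$ and the right child $J'=\langle m_1,\dots,m_{s-1}\rangle$. Nodes with a single minimal generator are leaves.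 Positions: the root has position $1$; left and right children of the node in position $p$ have positions $2p$ and $2p+1$. A node is relevant if its position is $1$ or even. Type $A$: $I$ is a Mayer-Vietoris ideal of type $A$ if there exists a Mayer-Vietoris tree of $I$ with no repeated generator in the ideals of the relevant nodes, i.e. no monomial is a minimal generator of two different relevant nodes. *)

(* Defs.v *)
From HB Require Import structures.
From mathcomp Require Import all_boot all_order all_algebra.
From mathcomp Require Import mpoly.

Set Implicit Arguments.
Unset Strict Implicit.
Unset Printing Implicit Defensive.

Import GRing.Theory.
Local Open Scope ring_scope.

(** Ideals of [{mpoly k[N]}] are represented by [Prop]-valued predicates, which
    are always compared extensionally, by [eq_ideal]. *)

Definition ideal (k : fieldType) (N : nat) := {mpoly k[N]} -> Prop.

Definition eq_ideal (k : fieldType) (N : nat) (I J : ideal k N) : Prop :=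
  forall p, I p <-> J p.

Definition capI (k : fieldType) (N : nat) (I J : ideal k N) : ideal k N :=
  fun p => I p /\ J p.

Definition gen_ideal (k : fieldType) (N : nat) (s : seq {mpoly k[N]}) :
    ideal k N :=
  fun p => exists c : 'I_(size s) -> {mpoly k[N]},
    p = \sum_(i < size s) c i * s`_i.

Definition mon_ideal (k : fieldType) (N : nat) (s : seq 'X_{1..N}) : ideal k N :=
  gen_ideal [seq 'X_[k, u] | u <- s].

(** Minimality is with respect to inclusion; it is enough to test the removal of
    one generator at a time. *)
Definition min_gens (k : fieldType) (N : nat) (I : ideal k N)
    (s : seq 'X_{1..N}) : Prop :=
  [/\ uniq s, eq_ideal (mon_ideal s) I
    & forall u, u \in s -> ~ eq_ideal (mon_ideal (rem u s)) I].

Definition min_generator (k : fieldType) (N : nat) (I : ideal k N)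
    (u : 'X_{1..N}) : Prop :=
  exists2 s, min_gens I s & u \in s.

Inductive ideal_tree (k : fieldType) (N : nat) : Type :=
| Leaf of ideal k N
| Node of ideal k N & ideal_tree k N & ideal_tree k N.

(** [is_MVT J t]: [t] is a Mayer-Vietoris tree of [J]; [u] is the pivot. There is
    no such tree for the zero ideal. *)
Inductive is_MVT (k : fieldType) (N : nat) :
    ideal k N -> ideal_tree k N -> Prop :=
| MVT_leaf J u of min_gens J [:: u] : is_MVT J (Leaf J)
| MVT_node J s u l r of
    min_gens J s & (2 <= size s)%N & u \in s &
    is_MVT (capI (mon_ideal (rem u s)) (mon_ideal [:: u])) l &
    is_MVT (mon_ideal (rem u s)) r :
    is_MVT J (Node J l r).

(** [node_at p t q J]: the tree [t], whose root is given position [p], has a node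
    labelled [J] in position [q]. *)
Fixpoint node_at (k : fieldType) (N : nat) (p : nat) (t : ideal_tree k N)
    (q : nat) (J : ideal k N) : Prop :=
  match t with
  | Leaf K => q = p /\ J = K
  | Node K l r =>
      [\/ q = p /\ J = K, node_at (2 * p) l q J | node_at (2 * p).+1 r q J]
  end.

Definition relevant (p : nat) : bool := (p == 1)%N || ~~ odd p.

Definition MV_typeA (k : fieldType) (N : nat) (I : ideal k N) : Prop :=
  exists2 t, is_MVT I t &
    forall p q J K u,
      node_at 1 t p J -> relevant p -> min_generator J u ->
      node_at 1 t q K -> relevant q -> min_generator K u ->
      p = q.

(** A bipartite graph on [x_1, .., x_n] and [y_1, .., y_m] is given by its edges
    [e i j], with indices shifted to start at [0]; both parts of a Ferrers graph
    are nonempty, whence the successors. *)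
Definition is_ferrers (n m : nat) (e : 'I_n.+1 -> 'I_m.+1 -> bool) : Prop :=
  [/\ forall (i p : 'I_n.+1) (j q : 'I_m.+1),
        e i j -> (p <= i)%N -> (q <= j)%N -> e p q,
      e ord0 ord_max & e ord_max ord0].

(** In [{mpoly k[n + m]}] the first [n] variables are the [x_i] and the last [m]
    ones the [y_j]. *)
Definition edge_ideal (k : fieldType) (n m : nat) (e : 'I_n -> 'I_m -> bool) :
    ideal k (n + m) :=
  gen_ideal [seq 'X_(lshift m ij.1) * 'X_(rshift n ij.2)
            | ij in [pred ij : 'I_n * 'I_m | e ij.1 ij.2]].

Arguments edge_ideal k {n m} e p.

(* Main.v *)
Require Import Defs.
From HB Require Import structures.
From mathcomp Require Import all_boot all_order all_algebra.
From mathcomp Require Import mpoly zify.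

Set Implicit Arguments.
Unset Strict Implicit.
Unset Printing Implicit Defensive.

Import GRing.Theory.
Local Open Scope ring_scope.

(** Order the edges of the Ferrers graph lexicographically, and take as pivot of
    every node on the rightmost branch its last edge [x_i y_j]. What is left in
    such a node are the edges [x_p y_q] with [p < i], or with [p = i] and [q < j].
    By the Ferrers property, [x_p y_j] is an edge for all [p < i] and [x_i y_q]
    for all [q < j], so that the left child is
      [x_i y_j * <x_1, .., x_(i-1), y_1, .., y_(j-1)>].
    In other words the edge ideal has linear quotients.

    An ideal [u * <z_1, .., z_s>] is treated in the same way: with pivot [u z_s],
    the left child is [u z_s * <z_1, .., z_(s-1)>], the right one
    [u * <z_1, .., z_(s-1)>], and induction applies to both ([koszul_MVT]). No
    generator is repeated there, because the exponent of [z_s] tells the left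
    subtree from the right one, and the degree tells a node from those below it.

    All the relevant generators produced by the pivot [x_i y_j] are in its cone,
    the set of products of [x_i y_j] by monomials in [x_p], [p < i], and [y_q],
    [q < j]. In such a product [x_i] and [y_j] are the last variable of each kind,
    so that the cones of distinct edges are disjoint ([cone_edge_inj]). Hence
    nothing is repeated between the subtrees of two edges
    ([linear_quotients_MVT]), nor at the root, whose generators have degree 2
    whereas those of the left children have degree at least 3.

    Ideals only matter through their monomials, so that all of this is checked on
    the upsets of monomials divisible by a generator ([eq_mon_ideal]). *)

(** * Monomial ideals as sets of monomials *)

Section MonomialIdeals.
Variables (k : fieldType) (N : nat).
Implicit Types (I J K : ideal k N) (s : seq 'X_{1..N}) (u v w : 'X_{1..N}).

Local Notation monI := (@mon_ideal k N).

Lemma gen_ideal0 (g : seq {mpoly k[N]}) : gen_ideal g 0.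
Proof. by exists (fun=> 0); rewrite big1 // => i _; rewrite mul0r. Qed.

Lemma gen_idealD (g : seq {mpoly k[N]}) p q :
  gen_ideal g p -> gen_ideal g q -> gen_ideal g (p + q).
Proof.
move=> [c ->] [d ->]; exists (fun i => c i + d i).
by rewrite -big_split; apply: eq_bigr => i _; rewrite mulrDl.
Qed.

Lemma gen_idealM (g : seq {mpoly k[N]}) a p :
  gen_ideal g p -> gen_ideal g (a * p).
Proof.
move=> [c ->]; exists (fun i => a * c i).
by rewrite mulr_sumr; apply: eq_bigr => i _; rewrite mulrA.
Qed.

Lemma mem_gen_ideal (g : seq {mpoly k[N]}) p : p \in g -> gen_ideal g p.
Proof.
move=> gp; have lt_i : (index p g < size g)%N by rewrite index_mem.
exists (fun j => (j == Ordinal lt_i)%:R).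
rewrite (bigD1 (Ordinal lt_i)) //= eqxx mul1r nth_index // big1 ?addr0 //.
by move=> j /negPf ->; rewrite mul0r.
Qed.

Definition in_upset s w := has (fun v => (v <= w)%MM) s.

Lemma in_upsetP s w :
  reflect (exists2 v, v \in s & (v <= w)%MM) (in_upset s w).
Proof. exact: hasP. Qed.

(** Multiplying a generator by any polynomial only produces multiples of that
    generator, and conversely a polynomial is the sum of its terms. *)
Lemma mon_idealP s p :
  monI s p <-> (forall w, w \in msupp p -> in_upset s w).
Proof.
split=> [[c ->] w /msupp_sum_le/flatten_mapP[i] | sp].
  rewrite filter_predT => _ /msuppM_le/allpairsP[[a b] /= [_]].
  have lt_i : (i < size s)%N by rewrite -(size_map (fun u => 'X_[k, u])).
  rewrite (nth_map 0%MM) // msuppX inE => /eqP -> ->.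
  by apply/in_upsetP; exists (nth 0%MM s i); rewrite ?mem_nth ?lem_addl.
rewrite [p]mpolyE big_seq; apply: (big_ind (monI s)).
- exact: gen_ideal0.
- exact: gen_idealD.
move=> w /sp/in_upsetP[v sv le_vw].
rewrite -(submK le_vw) mpolyXD scalerAl; apply: gen_idealM.
by apply: mem_gen_ideal; apply: map_f.
Qed.

Lemma mon_ideal_X s w : monI s 'X_[k, w] <-> in_upset s w.
Proof.
split=> [/mon_idealP|s_w]; first by apply; rewrite msuppX inE.
by apply/mon_idealP => v; rewrite msuppX inE => /eqP ->.
Qed.

Lemma eq_mon_ideal s s' :
  eq_ideal (monI s) (monI s') <-> in_upset s =1 in_upset s'.
Proof.
split=> [eqI w | eqU p].
  by apply/idP/idP; move/mon_ideal_X/eqI/mon_ideal_X.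
by split=> /mon_idealP sp; apply/mon_idealP => w /sp; rewrite eqU.
Qed.

Lemma eq_idealC I J : eq_ideal I J -> eq_ideal J I.
Proof. by move=> eqIJ p; split=> /eqIJ. Qed.

Lemma eq_ideal_trans J I K : eq_ideal I J -> eq_ideal J K -> eq_ideal I K.
Proof. by move=> eqIJ eqJK p; split=> [/eqIJ/eqJK | /eqJK/eqIJ]. Qed.

Lemma eq_min_gens I J s : eq_ideal I J -> min_gens I s -> min_gens J s.
Proof.
move=> eqIJ [s_uniq sI sI_min]; split=> //; first exact: eq_ideal_trans eqIJ.
move=> u su eqJ; apply: (sI_min u su).
exact: eq_ideal_trans eqJ (eq_idealC eqIJ).
Qed.

Lemma eq_min_generator I J u :
  eq_ideal I J -> min_generator I u -> min_generator J u.
Proof. by move=> eqIJ [s /(eq_min_gens eqIJ)]; exists s. Qed.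

Definition antichain s := {in s &, forall v w, (v <= w)%MM -> v = w}.

Lemma lepm_mdeg_eq v w : (v <= w)%MM -> mdeg v = mdeg w -> v = w.
Proof.
move=> le_vw; rewrite -(submK le_vw) mdegD => /esym/(canRL (addnK _)).
by rewrite subnn => /eqP; rewrite mdeg_eq0 => /eqP ->; rewrite add0m.
Qed.

Lemma homog_antichain d s : {in s, forall v, mdeg v = d} -> antichain s.
Proof. by move=> sd v w /sd dv /sd dw /lepm_mdeg_eq -> //; rewrite dv. Qed.

Lemma antichain_min_gens s :
  uniq s -> antichain s -> min_gens (monI s) s.
Proof.
move=> s_uniq s_anti; split=> // u su /eq_mon_ideal/(_ u).
have -> : in_upset s u by apply/in_upsetP; exists u; rewrite ?lepm_refl.
case/in_upsetP => v; rewrite mem_rem_uniq // inE => /andP[neq_vu sv] le_vu.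
by rewrite (s_anti v u) ?eqxx in neq_vu.
Qed.

(** A minimal generator [u] is divisible by an element of any other generating
    set, which is in turn divisible by a minimal generator; the latter has to be
    [u], so that all three monomials coincide. *)
Lemma min_generator_sub s u : min_generator (monI s) u -> u \in s.
Proof.
move=> [s' [s'_uniq /eq_mon_ideal eq_s's s'_min] s'u].
have: in_upset s u by rewrite -eq_s's;
  apply/in_upsetP; exists u; rewrite ?lepm_refl.
case/in_upsetP => v sv le_vu.
have: in_upset s' v by rewrite eq_s's;
  apply/in_upsetP; exists v; rewrite ?lepm_refl.
case/in_upsetP => w s'w le_wv; have le_wu := lepm_trans le_wv le_vu.
have [eq_wu | neq_wu] := eqVneq w u.
  suff -> : u = v by [].
  apply/mnmP => i; apply/eqP; rewrite eqn_leq (mnm_lepP le_vu) andbT.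
  by rewrite -{1}eq_wu (mnm_lepP le_wv).
case: (s'_min u s'u); apply: (eq_ideal_trans (J := monI s')); last first.
  exact/eq_mon_ideal.
apply/eq_mon_ideal => x; apply/in_upsetP/in_upsetP=> -[y].
  by move/mem_rem; exists y.
have [-> _ le_ux | neq_yu s'y le_yx] := eqVneq y u.
  by exists w; rewrite ?(lepm_trans le_wu) // mem_rem_uniq // inE neq_wu.
by exists y => //; rewrite mem_rem_uniq // inE neq_yu.
Qed.

(** * Trees without repeated generators *)

Definition label (t : ideal_tree k N) : ideal k N :=
  match t with Leaf J => J | Node J _ _ => J end.

(** In a Mayer-Vietoris tree, the label of a left child is by construction an
    intersection of ideals; [relabel] replaces the label at the root of a tree of
    an explicit monomial ideal by such an extensionally equal one. *)
Definition relabel (t : ideal_tree k N) J : ideal_tree k N :=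
  match t with Leaf _ => Leaf J | Node _ l r => Node J l r end.

(** The relevant nodes are the root and the left children. As the root of a subtree
    may be a left or a right child, its own generators are not counted here. *)
Fixpoint left_gen (t : ideal_tree k N) w : Prop :=
  match t with
  | Leaf _ => False
  | Node _ l r => [\/ min_generator (label l) w, left_gen l w | left_gen r w]
  end.

(** A form of the type [A] condition on which one can argue by induction on the
    tree, since it does not mention positions. *)
Fixpoint no_repeat (t : ideal_tree k N) : Prop :=
  match t with
  | Leaf _ => True
  | Node _ l r =>
    [/\ no_repeat l, no_repeat r,
        forall w, min_generator (label l) w -> ~ left_gen l w
      & forall w, min_generator (label l) w \/ left_gen l w -> ~ left_gen r w]
  end.

Lemma is_MVT_relabel I J t : is_MVT I t -> eq_ideal I J -> is_MVT J (relabel t J).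
Proof.
case=> {I t} [I u gensI | I s u l r gensI s_gt1 su MVTl MVTr] eqIJ /=.
  by left with u; apply: eq_min_gens gensI.
by right with s u => //; apply: eq_min_gens gensI.
Qed.

Lemma label_relabel t J : label (relabel t J) = J.
Proof. by case: t. Qed.

Lemma left_gen_relabel t J w : left_gen (relabel t J) w = left_gen t w.
Proof. by case: t. Qed.

Lemma no_repeat_relabel t J : no_repeat (relabel t J) = no_repeat t.
Proof. by case: t. Qed.

(** Positions increase along the branches, provided that they start from a
    positive one. *)
Lemma node_at_root t p q J :
  (0 < p)%N -> node_at p t q J -> (q = p /\ J = label t) \/ (p < q)%N.
Proof.
elim: t p => [K | K l IHl r IHr] p p_gt0 /=; first by left.
have lt_p2p : (p < 2 * p)%N by rewrite mul2n -addnn -{1}[p]addn0 ltn_add2l.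
case=> [|tq|tq]; [by left | right | right].
  case/IHl: tq => [|[-> //]|]; last exact: ltn_trans.
  by rewrite muln_gt0.
by case/IHr: tq => // [[-> _]|]; [exact: ltnW | apply: ltn_trans; exact: ltnW].
Qed.

(** Below the root, the relevant positions are exactly those of left children:
    a right child has an odd position greater than 1. *)
Lemma left_gen_node_at t p q J w :
    (0 < p)%N -> node_at p t q J -> relevant q -> min_generator J w -> q <> p ->
  left_gen t w.
Proof.
elim: t p => [K | K l IHl r IHr] p p_gt0 /=; first by case.
have p2_gt0 : (0 < 2 * p)%N by rewrite muln_gt0.
case=> [[]|tq|tq] // rel_q Jw _.
  case: (node_at_root p2_gt0 tq) => [[_ eqJ]|lt_q].
    by constructor 1; rewrite -eqJ.
  by constructor 2; apply: (IHl _ _ tq) => // eq_q; rewrite eq_q ltnn in lt_q.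
constructor 3; apply: (IHr _ _ tq) => // eq_q; move: rel_q.
by rewrite eq_q /relevant mul2n /= odd_double eqSS double_eq0 (gtn_eqF p_gt0).
Qed.

(** Two relevant nodes in different subtrees of a node, or at the root of its left
    subtree and below it, have no generator in common by [no_repeat]; two nodes
    in the same subtree, distinct from its root, are left to the induction. *)
Lemma no_repeat_unique t p q J q' J' w :
    (0 < p)%N -> no_repeat t ->
    node_at p t q J -> relevant q -> min_generator J w -> q <> p ->
    node_at p t q' J' -> relevant q' -> min_generator J' w -> q' <> p ->
  q = q'.
Proof.
move=> p_gt0 t_nr tq rel_q Jw neq_q tq' rel_q' J'w neq_q'.
elim: t p p_gt0 t_nr tq neq_q tq' neq_q' => [K | K l IHl r IHr] p p_gt0 /=.
  by move=> _ [].
have p2_gt0 : (0 < 2 * p)%N by rewrite muln_gt0.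
have odd_irr x : relevant x -> x <> (2 * p).+1.
  move=> rel_x eq_x; move: rel_x.
  by rewrite eq_x /relevant mul2n /= odd_double eqSS double_eq0 (gtn_eqF p_gt0).
have left_w x I : node_at (2 * p) l x I -> relevant x -> min_generator I w ->
    (x = 2 * p)%N /\ min_generator (label l) w \/ x <> (2 * p)%N /\ left_gen l w.
  move=> lx rel_x Iw; case: (node_at_root p2_gt0 lx) => [[-> <-]|lt_x]; first by left.
  have neq_x : x <> (2 * p)%N by move=> eq_x; rewrite eq_x ltnn in lt_x.
  by right; split=> //; apply: (left_gen_node_at p2_gt0 lx).
have right_w x I : node_at (2 * p).+1 r x I -> relevant x -> min_generator I w ->
    left_gen r w.
  by move=> rx rel_x Iw; apply: (left_gen_node_at _ rx) => //; exact: odd_irr.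
move=> [l_nr r_nr lab_l l_r] tq neq_q tq' neq_q'.
case: tq => [[]|lq|rq] //; case: tq' => [[]|lq'|rq'] //.
- case: (left_w _ _ lq) (left_w _ _ lq') => // [[-> lw]|[nq lw]].
    by case=> // [[-> //]|[_ /(lab_l _ lw)]].
  case=> // [[_ /lab_l/(_ lw) //]|[nq' _]].
  exact: (IHl _ p2_gt0 l_nr).
- case: (@l_r w _ (right_w _ _ rq' rel_q' J'w)).
  by case: (left_w _ _ lq) => // -[_ ?]; [left | right].
- case: (@l_r w _ (right_w _ _ rq rel_q Jw)).
  by case: (left_w _ _ lq') => // -[_ ?]; [left | right].
by apply: (IHr (2 * p).+1) => //; exact: odd_irr.
Qed.

Lemma no_repeat_typeA I t :
    is_MVT I t -> label t = I -> no_repeat t ->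
    (forall w, min_generator I w -> ~ left_gen t w) ->
  MV_typeA I.
Proof.
move=> MVTt lab_t t_nr root_t; exists t => // p q J K w tp rel_p Jw tq rel_q Kw.
case: (node_at_root _ tp) => // [[eq_p eqJ]|lt_p];
  case: (node_at_root _ tq) => // [[eq_q eqK]|lt_q].
- by rewrite eq_p eq_q.
- case: (root_t w); first by rewrite -lab_t -eqJ.
  by apply: (left_gen_node_at _ tq) => // eq_q; rewrite eq_q in lt_q.
- case: (root_t w); first by rewrite -lab_t -eqK.
  by apply: (left_gen_node_at _ tp) => // eq_p; rewrite eq_p in lt_p.
apply: (no_repeat_unique _ t_nr tp _ Jw _ tq _ Kw) => // eq1.
  by rewrite eq1 in lt_p.
by rewrite eq1 in lt_q.
Qed.

(** * Multiples of a prime monomial ideal *)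

(** The hypothesis on [b] says that [b] generates the left child for the pivot [u].
    Its tree [l] is used only up to the label of its root. *)
Lemma is_MVT_cons u s b l r :
    uniq (u :: s) -> antichain (u :: s) -> (0 < size s)%N ->
    (forall w, in_upset b w = in_upset s w && (u <= w)%MM) ->
    is_MVT (monI b) l -> is_MVT (monI s) r ->
  exists l', [/\ is_MVT (monI (u :: s)) (Node (monI (u :: s)) l' r),
                 eq_ideal (monI b) (label l'),
                 left_gen l' = left_gen l & no_repeat l' = no_repeat l].
Proof.
move=> us_uniq us_anti s_gt0 bE MVTl MVTr.
pose J := capI (monI s) (monI [:: u]).
have eqJ : eq_ideal (monI b) J.
  move=> f; split=> [/mon_idealP bf | [/mon_idealP sf /mon_idealP uf]].
    by split; apply/mon_idealP => w /bf; rewrite bE /in_upset /= ?orbF => /andP[].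
  by apply/mon_idealP => w fw; rewrite bE sf //;
    have := uf w fw; rewrite /in_upset /= orbF.
exists (relabel l J); rewrite label_relabel; split=> //; try by case: (l).
have rem_u : rem u (u :: s) = s by rewrite /= eqxx.
right with (u :: s) u; rewrite ?rem_u ?mem_head //.
  exact: antichain_min_gens.
exact: is_MVT_relabel MVTl eqJ.
Qed.

(** The multiples of [u] by monomials in the variables [zs]. *)
Definition cone u (zs : seq 'I_N) w :=
  (u <= w)%MM /\ (forall z, z \notin zs -> w z = u z).

Definition shift u (zs : seq 'I_N) := [seq (u + U_(z))%MM | z <- zs].

Lemma lem_addU u z w : (u + U_(z) <= w)%MM = (u <= w)%MM && (u z < w z)%N.
Proof.
apply/mnm_lepP/andP => [le_w | [/mnm_lepP le_w lt_z] i].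
  split; last by have := le_w z; rewrite mnmDE mnm1E eqxx addn1.
  by apply/mnm_lepP => i; apply: leq_trans (le_w i); rewrite mnmDE leq_addr.
by rewrite mnmDE mnm1E; case: eqP => [<-|_]; rewrite ?addn1 ?addn0.
Qed.

Lemma shift_mdeg u zs : {in shift u zs, forall v, mdeg v = (mdeg u).+1}.
Proof. by move=> _ /mapP[z _ ->]; rewrite mdegD mdeg1 addn1. Qed.

Lemma shift_uniq u zs : uniq zs -> uniq (shift u zs).
Proof.
by rewrite map_inj_uniq // => y z /addmI/(congr1 (fun v : 'X_{1..N} => v z));
  rewrite !mnm1E eqxx; case: eqP.
Qed.

Lemma in_upset_shift u zs w :
  in_upset (shift u zs) w = (u <= w)%MM && has (fun z => u z < w z)%N zs.
Proof.
rewrite /in_upset has_map -(@eq_has _ (fun z => (u <= w)%MM && (u z < w z)%N)).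
  by elim: zs => [|z zs IH] /=; rewrite ?andbF // IH; case: (_ <= _)%MM.
by move=> z; rewrite /= lem_addU.
Qed.

Lemma shift_cone u zs w : w \in shift u zs -> cone u zs w.
Proof.
case/mapP => z zs_z ->; split=> [|y]; first exact: lem_addr.
by move=> zs'y; rewrite mnmDE mnm1E; case: eqP zs'y => [<-|]; rewrite ?zs_z ?addn0.
Qed.

(** With pivot [u z], for [z] the head of the list, the monomials in the left
    subtree are multiples of [u z], whereas in the right subtree the exponent of
    [z] is the same as in [u]. Inside the left subtree, the generators of the root
    have degree [mdeg u + 2], and those below it a greater one. *)
Lemma koszul_MVT u zs :
    uniq zs -> (0 < size zs)%N ->
  exists t, [/\ is_MVT (monI (shift u zs)) t, label t = monI (shift u zs),
    no_repeat t & forall w, left_gen t w -> cone u zs w /\ (mdeg u + 2 <= mdeg w)%N].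
Proof.
elim: zs u => // z zs IH u zzs_uniq _.
have /andP[zs'z zs_uniq] := zzs_uniq.
have anti := homog_antichain (@shift_mdeg u (z :: zs)).
have [/size0nil zs0 | zs_gt0] := posnP (size zs).
  rewrite zs0 in anti *; exists (Leaf (monI (shift u [:: z]))); split=> //.
  by left with (u + U_(z))%MM; apply: antichain_min_gens.
have [l [MVTl lab_l l_nr lP]] := IH (u + U_(z))%MM zs_uniq zs_gt0.
have [r [MVTr lab_r r_nr rP]] := IH u zs_uniq zs_gt0.
have [|w|l' [MVTu lab_l' left_l' l'_nr]] :=
    is_MVT_cons (shift_uniq u zzs_uniq) anti _ _ MVTl MVTr.
- by rewrite size_map.
- rewrite !in_upset_shift lem_addU -/shift.
  case le_u: (u <= w)%MM => //=; rewrite andbC; congr (_ && _).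
  apply: eq_in_has => x zs_x; rewrite mnmDE mnm1E.
  by case: eqP zs_x => [<-|]; rewrite ?(negPf zs'z) ?addn0.
have lab_l'P w : min_generator (label l') w -> w \in shift (u + U_(z)) zs.
  by move/(eq_min_generator (eq_idealC lab_l'))/min_generator_sub.
have l'_cone w : min_generator (label l') w \/ left_gen l' w ->
    cone (u + U_(z)) zs w /\ (mdeg u + 2 <= mdeg w)%N.
  case=> [/lab_l'P lw|].
    by split; [exact: shift_cone | rewrite (shift_mdeg lw) mdegD mdeg1 addn2 addn1].
  rewrite left_l' => /lP[lw le_w]; split=> //.
  by apply: leq_trans le_w; rewrite mdegD mdeg1 leq_add2r leq_addr.
exists (Node (monI (shift u (z :: zs))) l' r); split=> //=.
  split=> //; first by rewrite l'_nr.
    move=> w /lab_l'P/shift_mdeg dw; rewrite left_l' => /lP[_].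
    by rewrite dw mdegD mdeg1 addn1 addn2 ltnn.
  move=> w /l'_cone[[/mnm_lepP/(_ z) le_wz _] _] /rP[[_ /(_ z zs'z) eq_wz] _].
  by move: le_wz; rewrite eq_wz mnmDE mnm1E eqxx addn1 ltnn.
have l'_ok w : min_generator (label l') w \/ left_gen l' w ->
    cone u (z :: zs) w /\ (mdeg u + 2 <= mdeg w)%N.
  case/l'_cone => -[le_w w_eq] le_d; split=> //; split.
    exact: lepm_trans (lem_addr _ _) le_w.
  move=> x; rewrite inE negb_or => /andP[neq_xz /w_eq ->].
  by rewrite mnmDE mnm1E eq_sym (negPf neq_xz) addn0.
move=> w [lw|lw|/rP[[le_w w_eq] le_d]]; try by apply: l'_ok; by [left | right].
by split=> //; split=> // x; rewrite inE negb_or => /andP[_ /w_eq].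
Qed.

(** * Linear quotients with disjoint cones *)

(** The fifth hypothesis says that the generators after [g i] in the list have a
    colon ideal by [g i] that is generated by the variables [Z i], so that for the
    pivot [g i] the left child is [g i * <Z i>]. As the monomials met in its
    subtree stay in the cone of [g i], disjointness of the cones prevents
    repetitions between the subtrees of distinct generators. *)
Lemma linear_quotients_MVT (T : eqType) (g : T -> 'X_{1..N})
    (Z : T -> seq 'I_N) (d : nat) (es : seq T) :
    (0 < size es)%N -> uniq es -> {in es, forall i, mdeg (g i) = d} ->
    {in es, forall i, uniq (Z i)} ->
    (forall es1 i es2 w, es = es1 ++ i :: es2 -> (g i <= w)%MM ->
      in_upset (map g es2) w = has (fun z => g i z < w z)%N (Z i)) ->
    {in es &, forall i j w, cone (g i) (Z i) w -> cone (g j) (Z j) w -> i = j} ->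
  exists t, [/\ is_MVT (monI (map g es)) t, label t = monI (map g es),
    no_repeat t
    & forall w, left_gen t w ->
        (exists2 i, i \in es & cone (g i) (Z i) w) /\ (d < mdeg w)%N].
Proof.
elim: es => // i es IH _ ies_uniq g_deg Z_uniq colon disj.
have g_inj : {in i :: es &, injective g}.
  move=> a b es_a es_b eq_g; apply: (disj a b es_a es_b (g a)).
    by split=> //; exact: lepm_refl.
  by rewrite eq_g; split=> //; exact: lepm_refl.
have ges_uniq : uniq (map g (i :: es)) by rewrite map_inj_in_uniq.
have anti : antichain (map g (i :: es)).
  by apply: (@homog_antichain d) => _ /mapP[a es_a ->]; exact: g_deg.
have [/size0nil es0 | es_gt0] := posnP (size es).
  rewrite es0 in ges_uniq anti *; exists (Leaf (monI (map g [:: i]))).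
  by split=> //; left with (g i); apply: antichain_min_gens.
have sub a : a \in es -> a \in i :: es by rewrite inE orbC => ->.
have /andP[es'i es_uniq] := ies_uniq.
have [|a /sub|a /sub|es1 a es2 w eq_es|a b /sub es_a /sub
  |r [MVTr lab_r r_nr rP]] := IH es_gt0.
- exact: es_uniq.
- exact: g_deg.
- exact: Z_uniq.
- by apply: (colon (i :: es1)); rewrite eq_es.
- exact: disj.
have i_es := mem_head i es.
have colon_i w : (g i <= w)%MM ->
    in_upset (map g es) w = has (fun z => g i z < w z)%N (Z i).
  exact: (colon [::]).
(* Were [Z i] empty, no later [g j] would divide a multiple of [g i], although
   it divides [g i + g j]. *)
have Z_gt0 : (0 < size (Z i))%N.
  case: es es_gt0 colon_i {IH ies_uniq g_deg Z_uniq colon disj g_inj ges_uniq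
    anti sub es'i es_uniq MVTr lab_r rP i_es} => // j es _.
  move/(_ (g i + g j)%MM (lem_addr _ _)).
  by rewrite /in_upset /= lem_addl; case: (Z i).
have [l [MVTl _ l_nr lP]] := koszul_MVT (g i) (Z_uniq i i_es) Z_gt0.
have [|w|l' [MVTi lab_l' left_l' l'_nr]] :=
  is_MVT_cons ges_uniq anti _ _ MVTl MVTr.
- by rewrite size_map.
- rewrite in_upset_shift andbC; case le_w: (g i <= w)%MM; rewrite ?andbF //.
  by rewrite colon_i.
have lab_l'P w : min_generator (label l') w -> w \in shift (g i) (Z i).
  by move/(eq_min_generator (eq_idealC lab_l'))/min_generator_sub.
have l'_cone w : min_generator (label l') w \/ left_gen l' w ->
    cone (g i) (Z i) w /\ (d < mdeg w)%N.
  case=> [/lab_l'P lw|].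
    by split; [exact: shift_cone | rewrite (shift_mdeg lw) g_deg].
  by rewrite left_l' => /lP[lw]; rewrite g_deg // addn2 => /ltnW.
exists (Node (monI (map g (i :: es))) l' r); split=> //=.
  split=> //; first by rewrite l'_nr.
    move=> w /lab_l'P/shift_mdeg dw; rewrite left_l' => /lP[_].
    by rewrite dw addn2 ltnn.
  move=> w /l'_cone[iw _] /rP[[j es_j jw] _].
  by move: es'i; rewrite (disj i j i_es (sub j es_j) w iw jw) es_j.
have ok_i w : min_generator (label l') w \/ left_gen l' w ->
    (exists2 j, j \in i :: es & cone (g j) (Z j) w) /\ (d < mdeg w)%N.
  by case/l'_cone=> iw dw; split=> //; exists i.
move=> w [lw|lw|/rP[[j es_j jw] dw]]; try by apply: ok_i; by [left | right].
by split=> //; exists j; rewrite ?sub.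
Qed.

End MonomialIdeals.

(** * Ferrers graphs *)

Section Ferrers.
Variables (n m : nat).
Implicit Types (a b : 'I_n * 'I_m) (w : 'X_{1..n + m}).

Definition edge_mon a : 'X_{1..n + m} :=
  (U_(lshift m a.1) + U_(rshift n a.2))%MM.

Lemma edge_mon_x a p : edge_mon a (lshift m p) = (a.1 == p) :> nat.
Proof. by rewrite mnmDE !mnm1E eq_lshift eq_rlshift addn0. Qed.

Lemma edge_mon_y a q : edge_mon a (rshift n q) = (a.2 == q) :> nat.
Proof. by rewrite mnmDE !mnm1E eq_rshift eq_lrshift. Qed.

Lemma edge_mon_le a w :
  (edge_mon a <= w)%MM = (0 < w (lshift m a.1))%N && (0 < w (rshift n a.2))%N.
Proof. by rewrite lem_addU lep1mP mnm1E eq_lrshift lt0n. Qed.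

(** For an edge [a = (i, j)] of a Ferrers graph, these are the variables that,
    multiplied by [x_i y_j], give a multiple of a lexicographically smaller edge. *)
Definition smaller_vars a : seq 'I_(n + m) :=
  [seq z <- enum 'I_(n + m) |
    match split z with inl p => (p < a.1)%N | inr q => (q < a.2)%N end].

Lemma mem_smaller_x a p : (lshift m p \in smaller_vars a) = (p < a.1)%N.
Proof. by rewrite mem_filter mem_enum andbT (unsplitK (inl p)). Qed.

Lemma mem_smaller_y a q : (rshift n q \in smaller_vars a) = (q < a.2)%N.
Proof. by rewrite mem_filter mem_enum andbT (unsplitK (inr q)). Qed.

Lemma has_smaller_vars a w :
  has (fun z => edge_mon a z < w z)%N (smaller_vars a) =
  [exists p : 'I_n, (p < a.1)%N && (0 < w (lshift m p))%N] ||
  [exists q : 'I_m, (q < a.2)%N && (0 < w (rshift n q))%N].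
Proof.
apply/hasP/orP => [[z] | [] /existsP[z /andP[lt_z w_z]]].
- rewrite -[z]splitK; case: (split z) => [p|q] /=.
    rewrite mem_smaller_x edge_mon_x => lt_p w_p; left; apply/existsP; exists p.
    by rewrite lt_p (leq_ltn_trans _ w_p).
  rewrite mem_smaller_y edge_mon_y => lt_q w_q; right; apply/existsP; exists q.
  by rewrite lt_q (leq_ltn_trans _ w_q).
- exists (lshift m z); first by rewrite mem_smaller_x.
  by rewrite edge_mon_x -val_eqE gtn_eqF.
exists (rshift n z); first by rewrite mem_smaller_y.
by rewrite edge_mon_y -val_eqE gtn_eqF.
Qed.

(** The edge is recovered from a monomial of its cone, as the pair of the last
    [x]-variable and the last [y]-variable of this monomial. *)
Lemma cone_edge_inj a b w :
    cone (edge_mon a) (smaller_vars a) w -> cone (edge_mon b) (smaller_vars b) w ->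
  a = b.
Proof.
suff le_ab c d : cone (edge_mon c) (smaller_vars c) w ->
    cone (edge_mon d) (smaller_vars d) w -> (c.1 <= d.1)%N && (c.2 <= d.2)%N.
  move=> aw bw; case/andP: (le_ab a b aw bw) (le_ab b a bw aw) => le1 le2.
  case/andP=> ge1 ge2.
  rewrite [a]surjective_pairing [b]surjective_pairing.
  by congr (_, _); apply/val_inj/eqP; rewrite /= eqn_leq ?le1 ?le2.
move=> [+ _] [_ w_d]; rewrite edge_mon_le => /andP[w_x w_y].
apply/andP; split; rewrite leqNgt; apply/negP => lt_dc.
  move: w_x; rewrite w_d; last by rewrite mem_smaller_x -leqNgt ltnW.
  by rewrite edge_mon_x -val_eqE (ltn_eqF lt_dc).
move: w_y; rewrite w_d; last by rewrite mem_smaller_y -leqNgt ltnW.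
by rewrite edge_mon_y -val_eqE (ltn_eqF lt_dc).
Qed.

(** Sorting along this relation puts the last edge, which is the pivot, at the head
    of the list. *)
Definition lex_ge a b := (b.1 < a.1)%N || (b.1 == a.1 :> nat) && (b.2 <= a.2)%N.

Lemma lex_ge_total : total lex_ge.
Proof. by move=> a b; rewrite /lex_ge; lia. Qed.

Lemma lex_ge_trans : transitive lex_ge.
Proof. by move=> b a c; rewrite /lex_ge; lia. Qed.

Lemma lex_ge_anti : antisymmetric lex_ge.
Proof.
move=> [a1 a2] [b1 b2]; rewrite /lex_ge /= => ab.
by congr (_, _); apply/val_inj => /=; lia.
Qed.

Variable e : 'I_n -> 'I_m -> bool.

Definition edges := sort lex_ge (enum [pred a | e a.1 a.2]).

Lemma mem_edges a : (a \in edges) = e a.1 a.2.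
Proof. by rewrite mem_sort mem_enum. Qed.

Lemma edges_uniq : uniq edges.
Proof. by rewrite sort_uniq enum_uniq. Qed.

Lemma edges_after s1 a s2 b :
  edges = s1 ++ a :: s2 -> (b \in s2) = [&& e b.1 b.2, lex_ge a b & b != a].
Proof.
move=> eq_es; have es_sorted :=
   sort_sorted lex_ge_total (enum [pred a | e a.1 a.2]).
move: es_sorted; rewrite -/edges (sorted_pairwise lex_ge_trans) eq_es.
rewrite pairwise_cat /= => /and3P[s1_ge _ /andP[/allP a_ge _]].
have:= edges_uniq; rewrite eq_es cat_uniq /= => /and3P[_ _ /andP[s2'a _]].
rewrite -mem_edges eq_es mem_cat inE.
apply/idP/and3P => [s2b | [s_b le_ba neq_ba]].
  by rewrite s2b !orbT a_ge //; split=> //; apply: contraNneq s2'a => <-.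
case/or3P: s_b => // [s1b | eq_ba]; last by rewrite eq_ba in neq_ba.
case/negP: neq_ba; apply/eqP/lex_ge_anti; rewrite le_ba andbT.
by move/allrelP: s1_ge => /(_ b a s1b (mem_head _ _)).
Qed.

(** If [x_i y_j] and the edge [x_p y_q] before it divide [w], then either
    [p < i], or [p = i] and [q < j]. Conversely [x_p y_j] and [x_i y_q] are edges
    when [p < i] and [q < j], by the Ferrers property. *)
Lemma ferrers_colon s1 a s2 w :
    (forall (i p : 'I_n) (j q : 'I_m),
      e i j -> (p <= i)%N -> (q <= j)%N -> e p q) ->
    edges = s1 ++ a :: s2 -> (edge_mon a <= w)%MM ->
  in_upset (map edge_mon s2) w =
  has (fun z => edge_mon a z < w z)%N (smaller_vars a).
Proof.
move=> e_down eq_es; rewrite edge_mon_le has_smaller_vars => /andP[w_x w_y].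
have e_a : e a.1 a.2 by rewrite -mem_edges eq_es mem_cat mem_head orbT.
apply/in_upsetP/orP => [[_ /mapP[b s2b ->]]|].
  move: s2b; rewrite (edges_after _ eq_es) edge_mon_le => /and3P[_ + neq_ba].
  case/orP=> [lt_ba | /andP[/eqP/val_inj eq1 le2]] /andP[wb_x wb_y].
    by left; apply/existsP; exists b.1; rewrite lt_ba.
  right; apply/existsP; exists b.2; rewrite wb_y andbT ltn_neqAle le2 andbT.
  apply: contraNneq neq_ba => /val_inj eq2.
  by rewrite [a]surjective_pairing [b]surjective_pairing eq1 eq2.
case=> /existsP[z /andP[lt_z w_z]].
  exists (edge_mon (z, a.2)); last by rewrite edge_mon_le w_z.
  rewrite map_f // (edges_after _ eq_es) /lex_ge /= lt_z.
  rewrite (e_down _ _ _ _ e_a) ?(ltnW lt_z) //.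
  by apply: contraTneq lt_z => <-; rewrite ltnn.
exists (edge_mon (a.1, z)); last by rewrite edge_mon_le w_x.
rewrite map_f // (edges_after _ eq_es) /lex_ge /= eqxx (ltnW lt_z) orbT.
rewrite (e_down _ _ _ _ e_a) ?(ltnW lt_z) //.
by apply: contraTneq lt_z => <-; rewrite ltnn.
Qed.

Lemma edge_idealE (k : fieldType) :
  eq_ideal (mon_ideal (k := k) (map edge_mon edges)) (edge_ideal k e).
Proof.
have -> : edge_ideal k e = mon_ideal (map edge_mon (enum [pred a | e a.1 a.2])).
  rewrite /edge_ideal /mon_ideal -map_comp; congr gen_ideal.
  by apply: eq_map => a; rewrite /= mpolyXD.
apply/eq_mon_ideal => w; apply: eq_has_r => v.
by apply: eq_mem_map => a; rewrite mem_sort.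
Qed.

End Ferrers.

Theorem proposition4p1p18 (k : fieldType) (char0 : [pchar k] =i pred0)
    (n m : nat) (e : 'I_n.+1 -> 'I_m.+1 -> bool) (ferrers_e : is_ferrers e) :
  MV_typeA (edge_ideal k e).
Proof.
have [e_down e_y _] := ferrers_e.
have es_gt0 : (0 < size (edges e))%N.
  by rewrite -has_predT; apply/hasP; exists (ord0, ord_max); rewrite ?mem_edges.
have es_deg : {in edges e, forall a, mdeg (edge_mon a) = 2%N}.
  by move=> a _; rewrite mdegD !mdeg1.
have [| | |t [MVTt lab_t t_nr tP]] :=
  linear_quotients_MVT k (Z := @smaller_vars _ _) es_gt0 (edges_uniq e) es_deg.
- by move=> a _; rewrite filter_uniq ?enum_uniq.
- by move=> s1 a s2 w; apply: ferrers_colon.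
- by move=> a b _ _ w; apply: cone_edge_inj.
have eqI := @edge_idealE _ _ e k.
apply: (no_repeat_typeA (is_MVT_relabel MVTt eqI)).
- exact: label_relabel.
- by rewrite no_repeat_relabel.
move=> w /(eq_min_generator (eq_idealC eqI))/min_generator_sub/mapP[a es_a ->].
by rewrite left_gen_relabel => /tP[_]; rewrite es_deg // ltnn.
Qed.
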